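(* Tight GFG-NSWs are co-Büchi-type: every tight GFG-NSW $\mathcal{A}=\langle\Sigma,Q,Q_0,\delta,\alpha\rangle$ whose language is recognized by some GFG-NCW has an equivalent GFG-NCW on the same structure, i.e. there is a set $\alpha'\subseteq Q$ such that $\langle\Sigma,Q,Q_0,\delta,\alpha'\rangle$, viewed as a co-Büchi automaton, is GFG and recognizes $L(\mathcal{A})$.
   Context: An automaton $\langle\Sigma,Q,Q_0,\delta,\alpha\rangle$ has $\delta:Q\times\Sigma\to2^Q$; runs are $r_0r_1\cdots$ with $r_0\in Q_0$, $r_{i+1}\in\delta(r_i,a_{i+1})$, accepting if the set $\inf(r)$ of infinitely visited states satisfies $\alpha$. Co-Büchi ($\alpha\subseteq Q$): $S$ accepting iff $S\cap\alpha=\emptyset$. Streett ($\alpha$ a set of pairs $\langle E,F\rangle$): $S$ accepting iff for every pair $S\cap E=\emptyset$ or $S\cap F\neq\emptyset$. NSW/NCW: nondeterministic Streett/co-Büchi word automaton. $\mathcal{A}$ is GFG if there is a strategy $g:\Sigma^*\to Q$ such that for every $w=a_1a_2\cdots$, $g(\epsilon),g(a_1),g(a_1a_2),\ldots$ is a run on $w$, accepting whenever $w\in L(\mathcal{A})$. Finite-state strategies are transducers $g=\langle\Sigma,Q,M,m_0,\rho,\tau\rangle$ (finite memories $M$, $\rho:M\times\Sigma\to M$ extended to words from $m_0$, $\tau:M\to Q$, $g(u)=\tau(\rho(u))$); $m$ is a memory of $q$ if $\tau(m)=q$. $\mathcal{A}_g=\langle\Sigma,M,m_0,\rho,\alpha_g\rangle$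 where $\alpha_g$ replaces each set $F$ in $\alpha$ by $\{m\mid\tau(m)\in F\}$. A transition $\langle q,a,q'\rangle$ is used by $g$ if $q=g(u)$, $q'=g(ua)$ for some $u$. For a set $P$ of finite paths, a combination is the union of state sets of a nonempty subset of $P$. For memories $m\neq m'$ with $\tau(m)=\tau(m')$, $m$ is replaceable by $m'$ if the set of paths of $\mathcal{A}_g$ from $m'$ to $m$ is empty or all its combinations are accepting w.r.t. $\alpha_g$. $\mathcal{A}$ is tight if for some finite-state strategy $g$ witnessing its GFGness, every transition of $\mathcal{A}$ is used by $g$ and no memory is replaceable by a different memory of the same state. *)

(* Defs.v *)
From mathcomp Require Import all_boot.
Set Implicit Arguments. Unset Strict Implicit. Unset Printing Implicit Defensive.

Section Automata.
Variables (Sigma Q : finType).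

(* An automaton <Sigma, Q, Q0, delta, alpha> is given by Q0 : {set Q},
   delta : Q -> Sigma -> {set Q} and an acceptance condition on sets of
   states, represented as a predicate on membership predicates (Q -> Prop).
   Infinite words a_1 a_2 ... are w : nat -> Sigma with w i = a_(i+1). *)

Definition is_run (Q0 : {set Q}) (delta : Q -> Sigma -> {set Q})
  (w : nat -> Sigma) (r : nat -> Q) : Prop :=
  r 0 \in Q0 /\ forall i, r i.+1 \in delta (r i) (w i).

Definition inf_of (T : Type) (r : nat -> T) (q : T) : Prop :=
  forall n, exists m, n <= m /\ r m = q.

Definition accepts (Q0 : {set Q}) (delta : Q -> Sigma -> {set Q})
  (acc : (Q -> Prop) -> Prop) (w : nat -> Sigma) : Prop :=
  exists r, is_run Q0 delta w r /\ acc (inf_of r).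

Definition prefix (w : nat -> Sigma) (n : nat) : seq Sigma := mkseq w n.

Definition is_gfg_strategy (Q0 : {set Q}) (delta : Q -> Sigma -> {set Q})
  (acc : (Q -> Prop) -> Prop) (g : seq Sigma -> Q) : Prop :=
  forall w : nat -> Sigma,
    is_run Q0 delta w (fun i => g (prefix w i)) /\
    (accepts Q0 delta acc w -> acc (inf_of (fun i => g (prefix w i)))).

Definition GFG (Q0 : {set Q}) (delta : Q -> Sigma -> {set Q})
  (acc : (Q -> Prop) -> Prop) : Prop :=
  exists g : seq Sigma -> Q, is_gfg_strategy Q0 delta acc g.

End Automata.

Definition streett_acc (T : finType) (alpha : seq ({set T} * {set T}))
  (S : T -> Prop) : Prop :=
  forall E F, (E, F) \in alpha ->
    (forall q, S q -> q \notin E) \/ (exists q, S q /\ q \in F).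

Definition cobuchi_acc (T : finType) (alpha : {set T}) (S : T -> Prop) : Prop :=
  forall q, S q -> q \notin alpha.

Record transducer (Sigma Q : finType) := Transducer {
  tM : finType;
  tm0 : tM;
  trho : tM -> Sigma -> tM;
  ttau : tM -> Q }.

Section Transducers.
Variables (Sigma Q : finType) (g : transducer Sigma Q).

Definition tmem (u : seq Sigma) : tM g := foldl (@trho _ _ g) (@tm0 _ _ g) u.

Definition strat (u : seq Sigma) : Q := ttau (tmem u).

Definition used (q : Q) (a : Sigma) (q' : Q) : Prop :=
  exists u, strat u = q /\ strat (rcons u a) = q'.

Definition alpha_g (alpha : seq ({set Q} * {set Q})) : seq ({set tM g} * {set tM g}) :=
  map (fun EF : {set Q} * {set Q} =>
     ([set m : tM g | ttau m \in EF.1], [set m : tM g | ttau m \in EF.2])) alpha.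

Definition gstep (x y : tM g) : bool := [exists a, trho x a == y].

Definition is_path_from_to (m' m : tM g) (p : seq (tM g)) : Prop :=
  exists s, p = m' :: s /\ path gstep m' s /\ last m' s = m.

Definition all_combinations_accepting (P : seq (tM g) -> Prop)
  (acc : (tM g -> Prop) -> Prop) : Prop :=
  forall Ps : seq (tM g) -> Prop,
    (exists p, Ps p) -> (forall p, Ps p -> P p) ->
    acc (fun m => exists p, Ps p /\ m \in p).

Definition replaceable (alpha : seq ({set Q} * {set Q})) (m m' : tM g) : Prop :=
  m <> m' /\ ttau m = ttau m' /\
  ((forall p, ~ is_path_from_to m' m p) \/
   all_combinations_accepting (is_path_from_to m' m) (streett_acc (alpha_g alpha))).

End Transducers.

Definition tight (Sigma Q : finType) (Q0 : {set Q}) (delta : Q -> Sigma -> {set Q})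
  (alpha : seq ({set Q} * {set Q})) : Prop :=
  exists g : transducer Sigma Q,
    is_gfg_strategy Q0 delta (streett_acc alpha) (strat g) /\
    (forall q a q', q' \in delta q a -> used g q a q') /\
    (forall m m' : tM g, ~ replaceable alpha m m').

(* Main.v *)
Require Import Defs.
From mathcomp Require Import all_boot.
From Stdlib Require Import Classical ClassicalEpsilon FunctionalExtensionality.

(** Let alpha' consist of the states that lie on no accepting cycle of A.  An
    accepting run ends up in an accepting cycle, hence avoids alpha'.
    Conversely, since every transition is used by the strategy g, residuals of
    the language are exact along every path of A: whether a word belongs to the
    language is unaffected by inserting, in a run, a cycle of A finitely often.
    Suppose that a run r on w avoids alpha' in the limit but w is not in L(A).
    Streett acceptance is closed under union, so the accepting cycles through
    the states visited infinitely often by r combine into one accepting cycle T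
    containing all of them.  Insert T infinitely often, each time only after the
    strategy of the co-Buchi automaton has visited a rejecting state again; this
    always happens, because finitely many insertions leave the word outside the
    language.  The limit word is accepted by A (its run visits exactly T
    infinitely often) and rejected by the co-Buchi automaton. *)

Section Automata.
Set Implicit Arguments.
Unset Strict Implicit.
Local Notation prefix := Defs.prefix.

(** * States visited infinitely often, and Streett acceptance of unions *)

Lemma classical_set (T : finType) (P : T -> Prop) :
  exists A : {set T}, forall x, x \in A <-> P x.
Proof.
exists [set x | if excluded_middle_informative (P x) then true else false] => x.
by rewrite inE; case: excluded_middle_informative.
Qed.

Lemma finite_bound (T : finType) (P : T -> nat -> Prop) :
  (forall x, exists n, P x n) ->
  exists N, forall x, exists2 n, n <= N & P x n.
Proof.
move=> PT.
pose f x := proj1_sig (constructive_indefinite_description _ (PT x)).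
exists (\max_x f x) => x; exists (f x); first exact: leq_bigmax.
by rewrite /f; case: constructive_indefinite_description.
Qed.

Lemma eventually_inf (T : finType) (r : nat -> T) :
  exists N, forall n, N <= n -> inf_of r (r n).
Proof.
have [x|N NP] := @finite_bound T
    (fun x k => inf_of r x \/ forall m, k <= m -> r m <> x).
  case: (classic (inf_of r x)) => [xi|nxi]; first by exists 0; left.
  have [k kP] := not_all_ex_not _ _ nxi; exists k; right=> m km rm.
  by apply: kP; exists m.
exists N => n Nn; have [k kN [//|kP]] := NP (r n).
by case: (kP n (leq_trans kN Nn)).
Qed.

Lemma inf_visited (T : finType) (r : nat -> T) a :
  exists b, forall x, inf_of r x -> exists2 n, a <= n <= b & r n = x.
Proof.
have [x|b bP] := @finite_bound T
    (fun x n => inf_of r x -> a <= n /\ r n = x).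
  case: (classic (inf_of r x)) => [xi|nxi]; last by exists 0.
  by have [n nP] := xi a; exists n.
exists b => x xi; have [n nb /(_ xi)[an rn]] := bP x.
by exists n; rewrite ?an.
Qed.

Definition shift (T : Type) (k : nat) (f : nat -> T) (i : nat) : T := f (k + i).

Lemma inf_shift (T : Type) k (r : nat -> T) q :
  inf_of (shift k r) q <-> inf_of r q.
Proof.
split=> rq n.
  have [m [nm <-]] := rq n; exists (k + m); split=> //.
  exact: leq_trans nm (leq_addl _ _).
have [m [nm <-]] := rq (k + n); have km := leq_trans (leq_addr n k) nm.
by exists (m - k); rewrite /shift subnKC // -(leq_add2l k) subnKC.
Qed.

Lemma streett_acc_ext (T : finType) (alpha : seq ({set T} * {set T}))
    (S S' : T -> Prop) :
  (forall q, S q <-> S' q) -> streett_acc alpha S -> streett_acc alpha S'.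
Proof.
move=> SS' accS E F /accS[nE|[q [/SS' Sq qF]]]; last by right; exists q.
by left=> q /SS'; apply: nE.
Qed.

(** For each pair, a visit to [F] in either set survives in the union; failing that, both sets avoid
    [E], and so does the union. *)
Lemma streett_accU (T : finType) (alpha : seq ({set T} * {set T}))
    (S S' : T -> Prop) :
  streett_acc alpha S -> streett_acc alpha S' ->
  streett_acc alpha (fun q => S q \/ S' q).
Proof.
move=> aS aS' E F EF; case: (aS _ _ EF) => [nE|[q [Sq qF]]]; last first.
  by right; exists q; split=> //; left.
case: (aS' _ _ EF) => [nE'|[q [Sq qF]]]; last by right; exists q; split=> //; right.
by left=> q [/nE|/nE'].
Qed.

(** * Words with a finite prefix, and finite pieces of runs *)

Variables (Sigma Q : finType) (delta : Q -> Sigma -> {set Q}).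

Definition catw (u : seq Sigma) (x : nat -> Sigma) (i : nat) : Sigma :=
  if i < size u then nth (x 0) u i else x (i - size u).

Lemma catw_cat u v x : catw (u ++ v) x = catw u (catw v x).
Proof.
apply: functional_extensionality => i.
rewrite /catw size_cat nth_cat; case: ltnP => [iuv|uvi].
  case: ltnP => [iu|ui]; first exact: set_nth_default.
  by rewrite ltn_subLR // iuv.
have ui := leq_trans (leq_addr _ _) uvi.
by rewrite ltnNge ui /= ltn_subLR // ltnNge uvi /= subnDA.
Qed.

Lemma shift_catw u x : shift (size u) (catw u x) = x.
Proof.
apply: functional_extensionality => i.
by rewrite /shift /catw ltnNge leq_addr /= addKn.
Qed.

Lemma prefix_catw u x m :
  prefix (catw u x) (size u + m) = u ++ prefix x m.
Proof.
rewrite /prefix /mkseq iotaD map_cat add0n; congr (_ ++ _).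
  case: u => [//|a u]; apply: (@eq_from_nth _ a); first by rewrite size_map size_iota.
  move=> i; rewrite size_map size_iota => iu.
  by rewrite (nth_map 0) ?size_iota // nth_iota // /catw iu; apply: set_nth_default.
rewrite -[size u]addn0 iotaDl -map_comp; apply: eq_map => i /=.
exact: (congr1 (fun f => f i) (shift_catw u x)).
Qed.

Definition steps (w : nat -> Sigma) (r : nat -> Q) : Prop :=
  forall i, r i.+1 \in delta (r i) (w i).

Lemma steps_shift k w r : steps w r -> steps (shift k w) (shift k r).
Proof. by move=> wr i; rewrite /shift addnS. Qed.

(* A path is a sequence of (letter, target state) pairs; its source is the
   state component of the head passed to [path], whose letter is irrelevant. *)
Definition edge (x y : Sigma * Q) : bool := y.2 \in delta x.2 y.1.

Definition run_path (w : nat -> Sigma) (r : nat -> Q) (i k : nat) :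
  seq (Sigma * Q) := mkseq (fun t => (w (i + t), r (i + t).+1)) k.

Lemma run_pathS w r i k :
  run_path w r i k.+1 = rcons (run_path w r i k) (w (i + k), r (i + k).+1).
Proof. exact: mkseqS. Qed.

Lemma run_path_path w r i k a : steps w r ->
  path edge (a, r i) (run_path w r i k) /\
  (last (a, r i) (run_path w r i k)).2 = r (i + k).
Proof.
move=> wr; elim: k => [|k [IHp IHl]]; first by rewrite addn0.
rewrite run_pathS rcons_path last_rcons IHp /edge IHl /= addnS.
by split.
Qed.

Lemma run_path_states w r i k q :
  q \in map snd (run_path w r i k) <-> exists2 n, i < n <= i + k & r n = q.
Proof.
rewrite /run_path /mkseq -map_comp; split.
  move=> /mapP[t]; rewrite mem_iota /= add0n => tk ->.
  by exists (i + t).+1; rewrite // ltnS leq_addr /= -addnS leq_add2l.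
case=> [[//|n]] /andP[i_n nk] <-; apply/mapP; exists (n - i) => /=.
  by rewrite mem_iota /= add0n ltn_subLR.
by rewrite subnKC.
Qed.

Lemma run_path_labels w r i k :
  map fst (run_path w r i k) = prefix (shift i w) k.
Proof. by rewrite /run_path /mkseq -map_comp. Qed.

(** * Languages of states, and accepting loops *)

Variables (Q0 : {set Q}) (alpha : seq ({set Q} * {set Q})).
Local Notation acc := (streett_acc alpha).

Definition lang (q : Q) (w : nat -> Sigma) : Prop :=
  exists r, [/\ r 0 = q, steps w r & acc (inf_of r)].

Lemma accepts_lang w : accepts Q0 delta acc w <-> exists2 q, q \in Q0 & lang q w.
Proof.
split=> [[r [[r0 wr] ar]]|[q qQ [r [r0 wr ar]]]].
  by exists (r 0) => //; exists r.
by exists r; split=> //; split=> //; rewrite r0.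
Qed.

Lemma lang_splice w r k : steps w r -> lang (r k) (shift k w) -> lang (r 0) w.
Proof.
move=> wr [s [s0 ws as_]].
pose t i := if i < k then r i else s (i - k).
have ts : shift k t = s.
  apply: functional_extensionality => i.
  by rewrite /shift /t ltnNge leq_addr /= addKn.
exists t; split.
- by rewrite /t; case: ltnP => //; rewrite leqn0 => /eqP k0; rewrite s0 k0.
- move=> i; rewrite /t; case: (ltngtP i.+1 k) => [ik|ki|ik].
  + exact: wr.
  + rewrite ltnS in ki; rewrite subSn //.
    by have := ws (i - k); rewrite /shift subnKC.
  by rewrite ik subnn s0 -ik; apply: wr.
apply: streett_acc_ext as_ => q.
by rewrite -[s]ts; apply: inf_shift.
Qed.

Lemma lang_shift w r k : steps w r -> acc (inf_of r) -> lang (r k) (shift k w).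
Proof.
move=> wr ar; exists (shift k r); split; first by rewrite /shift addn0.
  exact: steps_shift.
by apply: streett_acc_ext ar => q; apply: iff_sym; apply: inf_shift.
Qed.

(** For a state merely reachable on [v], only the direction from [lang q x] to acceptance is
    automatic; the converse says that moving to [q] has lost no word. *)
Definition residual (v : seq Sigma) (q : Q) : Prop :=
  forall x, accepts Q0 delta acc (catw v x) <-> lang q x.

(** The quantified [a] is the dummy letter of the head. Listing targets only loses no state, since
    the source [q] is also the last target. *)
Definition accepting_loop (q : Q) : Prop :=
  exists p : seq (Sigma * Q), forall a,
    [/\ p != [::], path edge (a, q) p, (last (a, q) p).2 = q
      & acc (fun s => s \in map snd p)].

Lemma accepting_run_loop w r q :
  steps w r -> acc (inf_of r) -> inf_of r q -> accepting_loop q.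
Proof.
move=> wr ar rq; have [N NP] := eventually_inf r.
(* The loop is the piece of the run between two visits to [q]: the first comes after all finitely
   visited states have died out, the second after every infinitely visited state has been seen
   again. The search starts at [i.+1] because [run_path] omits its source. *)
have [i [Ni ri]] := rq N; have [b bP] := inf_visited r i.+1.
have [j [bj rj]] := rq b.
have ij : i < j.
  have [n /andP[i_n nb] _] := bP _ rq.
  exact: leq_trans i_n (leq_trans nb bj).
exists (run_path w r i (j - i)) => a; have := run_path_path i (j - i) a wr.
rewrite ri subnKC 1?ltnW // rj => -[pp pl]; split=> //.
  by rewrite -size_eq0 size_mkseq subn_eq0 -ltnNge.
apply: streett_acc_ext ar => s; rewrite run_path_states subnKC 1?ltnW //; split.
  move=> /bP[n /andP[i_n nb] rn]; exists n; rewrite // i_n.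
  exact: leq_trans nb bj.
by case=> n /andP[i_n _] <-; apply: NP; apply: leq_trans Ni (ltnW i_n).
Qed.

Lemma accepting_segment w r : steps w r -> (forall n, accepting_loop (r n)) ->
  forall n, exists p : seq (Sigma * Q), forall a,
    [/\ p != [::], path edge (a, r 0) p, (last (a, r 0) p).2 = r n,
        forall k, k <= n -> r k \in map snd p
      & acc (fun s => s \in map snd p)].
Proof.
have endin a q p : p != [::] -> (last (a, q) p).2 \in map snd p.
  by case: p => //= y p _; rewrite -(last_map snd) mem_last.
move=> wr loops; elim=> [|n [p pP]].
  have [p pP] := loops 0; exists p => a; have [p0 pp pl ap] := pP a.
  split=> // k; rewrite leqn0 => /eqP->.
  by rewrite -[X in X \in _]pl endin.
(* Take the edge to [r n.+1], then an accepting loop there. The edge adds no state beyond those of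
   [c], so the state set is a union of two accepting sets. *)
have [c cP] := loops n.+1; exists (p ++ (w n, r n.+1) :: c) => a.
have [p0 pp pl pn ap] := pP a; have [c0 cp cl ac] := cP (w n).
have rc : r n.+1 \in map snd c by rewrite -[X in X \in _]cl endin.
split.
- by case: (p) p0.
- by rewrite cat_path pp /= cp andbT /edge pl /=.
- by rewrite last_cat.
- move=> k; rewrite map_cat mem_cat leq_eqVlt => /orP[/eqP->|kn].
    by rewrite in_cons eqxx orbT.
  by rewrite pn.
apply: streett_acc_ext (streett_accU ap ac) => s.
rewrite map_cat mem_cat in_cons /=; split; first by case=> ->; rewrite ?orbT.
by case/or3P => [->|/eqP->|->]; auto.
Qed.

Lemma accepting_cycle w r : steps w r ->
  (forall n, inf_of r (r n)) -> (forall n, accepting_loop (r n)) ->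
  exists p : seq (Sigma * Q), forall a,
    [/\ p != [::], path edge (a, r 0) p, (last (a, r 0) p).2 = r 0,
        forall n, r n \in map snd p
      & acc (fun s => s \in map snd p)].
Proof.
move=> wr rinf loops; have [b bP] := inf_visited r 0.
(* A return to [r 0] after every state has been seen closes the segment into a cycle. *)
have [n [bn rn]] := rinf 0 b.
have [p pP] := accepting_segment wr loops n.
exists p => a; have [p0 pp pl pn ap] := pP a; split=> // [|k]; first by rewrite pl.
have [m /= mb <-] := bP _ (rinf k); apply: pn; exact: leq_trans mb bn.
Qed.

(** * Exactness of residuals along paths *)

Variable g : seq Sigma -> Q.
Hypothesis g_gfg : is_gfg_strategy Q0 delta acc g.
Hypothesis g_uses : forall q a q', q' \in delta q a ->
  exists u, g u = q /\ g (rcons u a) = q'.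

Lemma residual_strategy u : residual u (g u).
Proof.
move=> x; have [[r0 wr] wacc] := g_gfg (catw u x).
set r := fun i => _ in r0 wr wacc.
have ru : r (size u) = g u.
  by rewrite /r -[size u]addn0 prefix_catw cats0.
rewrite -ru -[X in lang _ X](shift_catw u x); split; first by move/wacc; apply: lang_shift.
by move=> /(lang_splice wr) lr; apply/accepts_lang; exists (r 0).
Qed.

(** The edge is used by [g] after some [u] with [g u = q], so [v] and [u] have the same residual
    language. Hence so do their extensions by [a], and the strategy is exact at [q']. *)
Lemma residual_edge v q a q' : residual v q -> q' \in delta q a ->
  residual (rcons v a) q'.
Proof.
move=> vq /g_uses[u [gq gq']] x.
rewrite -gq' -residual_strategy -!cats1 !catw_cat.
by rewrite (vq _) (residual_strategy u _) gq.
Qed.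

Lemma residual_path v a q p : residual v q -> path edge (a, q) p ->
  residual (v ++ map fst p) (last (a, q) p).2.
Proof.
elim: p v a q => [|[b q'] p IHp] v a q vq /=; first by rewrite cats0.
case/andP=> qq' pp; rewrite -cat_rcons.
exact: IHp (residual_edge vq qq') pp.
Qed.

(** * Rejection as seen by the co-Büchi strategy *)

Variables (Q' : finType) (Q0' : {set Q'}) (delta' : Q' -> Sigma -> {set Q'}).
Variables (beta : {set Q'}) (h : seq Sigma -> Q').
Hypothesis h_gfg : is_gfg_strategy Q0' delta' (cobuchi_acc beta) h.
Hypothesis h_lang : forall w,
  accepts Q0' delta' (cobuchi_acc beta) w <-> accepts Q0 delta acc w.

Lemma rejected_visits w : ~ accepts Q0 delta acc w ->
  forall n, exists2 m, n <= m & h (prefix w m) \in beta.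
Proof.
move=> nw n; have [wr _] := h_gfg w; apply: NNPP => nm; apply: nw.
apply/h_lang; eexists; split; first exact: wr.
move=> q qinf; apply/negP => qb; have [m [n_m mq]] := qinf n.
by apply: nm; exists m; rewrite // mq.
Qed.

Lemma visits_rejected w :
  (forall n, exists2 m, n <= m & h (prefix w m) \in beta) ->
  ~ accepts Q0 delta acc w.
Proof.
move=> vis /h_lang hw; have [_ /(_ hw) hacc] := h_gfg w.
have [N NP] := eventually_inf (fun i => h (prefix w i)).
by have [m /NP/hacc/negP] := vis N.
Qed.

(** * Inserting the accepting cycle infinitely often *)

Section Pumping.
Variables (v0 : seq Sigma) (w : nat -> Sigma) (r : nat -> Q).
Variable cyc : seq (Sigma * Q).
Hypothesis v0_res : residual v0 (r 0).
Hypothesis wr : steps w r.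
Hypothesis w_rej : ~ lang (r 0) w.
Hypothesis r_inf : forall n, inf_of r (r n).
Hypothesis cyc_neq0 : cyc != [::].
Hypothesis cyc_path : forall a, path edge (a, r 0) cyc.
Hypothesis cyc_last : forall a, (last (a, r 0) cyc).2 = r 0.
Hypothesis r_cyc : forall n, r n \in map snd cyc.
Hypothesis cyc_acc : acc (fun s => s \in map snd cyc).

Let d := (w 0, r 0).

(** A configuration is the path built so far from [r 0], together with the position of [r] from
    which it can be continued. *)
Definition config_ok (c : seq (Sigma * Q) * nat) : Prop :=
  [/\ path edge d c.1, (last d c.1).2 = r c.2 &
      forall q, q \in map snd c.1 -> q \in map snd cyc].

Definition pump_step (c c' : seq (Sigma * Q) * nat) : Prop :=
  [/\ config_ok c',
      exists s, [/\ c'.1 = c.1 ++ s, s != [::] &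
                    forall q, q \in map snd cyc -> q \in map snd s] &
      exists2 m, size c.1 <= m <= size c'.1 &
                 h (v0 ++ take m (map fst c'.1)) \in beta].

Lemma pump c : config_ok c -> exists c', pump_step c c'.
Proof.
case: c => V i [/= Vp Vl Vcyc].
(* By exactness, acceptance here would make [r i] accept the rest of [w], and splicing with the
   start of [r] would give [lang (r 0) w]. *)
have nacc : ~ accepts Q0 delta acc (catw (v0 ++ map fst V) (shift i w)).
  move=> /(residual_path v0_res Vp _).
  by rewrite Vl => /(lang_splice wr).
have [m vm mb] := rejected_visits nacc (size (v0 ++ map fst V)).
(* Follow [r] past the next visit of [h] to [beta] until it is back at [r 0], where [cyc] can be
   inserted; this visit depends only on letters read before the insertion. *)
have [j [ij rj]] := r_inf 0 (i + (m - size (v0 ++ map fst V))).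
have mE := subnKC vm; set k := m - _ in ij mE.
have i_j := leq_trans (leq_addr _ _) ij.
have jk : k <= j - i by rewrite -(leq_add2l i) subnKC.
have [pp pl] := run_path_path i (j - i) (last d V).1 wr.
rewrite -Vl -surjective_pairing subnKC // rj in pp pl.
set p := run_path _ _ _ _ in pp pl.
exists (V ++ (p ++ cyc), j); split.
- have [cp cl] : path edge (last (last d V) p) cyc /\
      (last (last (last d V) p) cyc).2 = r 0.
    by case: (last _ p) pl => a q /= ->.
  split=> /=; [by rewrite !cat_path Vp pp | by rewrite !last_cat cl rj | ].
  move=> q; rewrite !map_cat !mem_cat => /or3P[/Vcyc||] //.
  by move=> /run_path_states[n _ <-].
- exists (p ++ cyc); split=> //=; first by case: (p) cyc_neq0.
  by move=> q qc; rewrite map_cat mem_cat qc orbT.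
exists (size V + k) => /=.
  rewrite leq_addr !size_cat leq_add2l size_mkseq.
  exact: leq_trans jk (leq_addr _ _).
move: mb; rewrite -mE prefix_catw -catA.
set u := (map fst V ++ _); suff -> : take (size V + k) (map fst (V ++ p ++ cyc)) = u by [].
rewrite /u !map_cat take_cat size_map ltnNge leq_addr /= addKn; congr (_ ++ _).
rewrite take_cat size_map size_mkseq run_path_labels.
have take_pre n : k <= n -> take k (prefix (shift i w) n) = prefix (shift i w) k.
  by move=> kn; rewrite /prefix /mkseq -map_take take_iota (minn_idPl kn).
case: ltnP => [_|kj]; first by rewrite take_pre.
have -> : k = j - i by apply/eqP; rewrite eqn_leq jk.
by rewrite subnn take0 cats0.
Qed.

Lemma pump_contradiction : False.
Proof.
(* Dependent choice iterates [pump] from the empty path; the subset type carries the invariant. *)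
pose next (c : {c | config_ok c}) :=
  constructive_indefinite_description _ (pump (proj2_sig c)).
have ok0 : config_ok ([::], 0) by [].
pose C := fix C k : {c | config_ok c} := if k is k'.+1 then
  exist _ (proj1_sig (next (C k'))) (let: And3 ok _ _ := proj2_sig (next (C k')) in ok)
  else exist _ _ ok0.
pose V k := (proj1_sig (C k)).1.
have CS k : pump_step (proj1_sig (C k)) (proj1_sig (C k.+1)).
  exact: proj2_sig (next (C k)).
have Vok k : path edge d (V k) /\ forall q, q \in map snd (V k) -> q \in map snd cyc.
  by have [] := proj2_sig (C k).
have VS k : exists s, [/\ V k.+1 = V k ++ s, s != [::] &
    forall q, q \in map snd cyc -> q \in map snd s] by have [] := CS k.
have Vsize k : k <= size (V k).
  elim: k => // k IHk; have [s [-> s0 _]] := VS k.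
  by rewrite size_cat -addn1 leq_add // lt0n size_eq0.
have Vmono j k : j <= k -> exists s, V k = V j ++ s.
  move/subnKC <-; elim: (k - j) => [|n [s IH]]; first by exists [::]; rewrite addn0 cats0.
  have [s' [VE _ _]] := VS (j + n).
  by exists (s ++ s'); rewrite addnS VE IH catA.
(* Stage [n.+1] has more than [n] entries and later stages only extend it, so this entry is final
   and the default is never read. *)
pose X n := nth d (V n.+1) n.
have XE k n : n < size (V k) -> nth d (V k) n = X n.
  move=> nk; rewrite /X; case: (leqP k n.+1) => [/Vmono[s ->]|/ltnW/Vmono[s ->]].
    by rewrite nth_cat nk.
  by rewrite nth_cat Vsize.
pose x n := (X n).1; pose R n := if n is n'.+1 then (X n').2 else r 0.
have xV k m : m <= size (V k) -> take m (map fst (V k)) = prefix x m.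
  move=> mk; apply: (@eq_from_nth _ (w 0)); rewrite size_takel ?size_map ?size_iota //.
  move=> n nm; have nk := leq_trans nm mk.
  by rewrite nth_take // nth_mkseq // (nth_map d) // XE.
have xR : steps x R.
  move=> n; have /(pathP d)/(_ n (Vsize n.+1)) := (Vok n.+1).1.
  by rewrite /edge; case: n => //= n; rewrite (XE _ _ (ltnW (Vsize n.+2))).
have Rcyc n q : R n.+1 = q -> q \in map snd cyc.
  move=> <-; apply: (Vok n.+1).2; apply/map_f/mem_nth; exact: Vsize.
have cycR q : q \in map snd cyc -> inf_of R q.
  move=> qc n; have [s [VE _ /(_ q qc)/mapP[y ys ->]]] := VS n.
  exists (size (V n) + index y s).+1; split.
    exact: leqW (leq_trans (Vsize n) (leq_addr _ _)).
  rewrite /= -(XE n.+1) VE; last by rewrite size_cat ltn_add2l index_mem.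
  by rewrite nth_cat ltnNge leq_addr /= addKn nth_index.
(* Each stage traverses [cyc] and adds no state outside it, so [R] visits exactly the states of
   [cyc] infinitely often. *)
have : accepts Q0 delta acc (catw v0 x).
  apply/v0_res; exists R; split=> //; apply: streett_acc_ext cyc_acc => q.
  split=> [/cycR //|/(_ 1)[[|n] [] // _ Rn]]; exact: Rcyc Rn.
(* Stage [n] contributes a visit to [beta] after at least [size (V n)], hence at least [n], letters
   beyond [v0]. *)
apply: visits_rejected => n; have [_ _ [m /andP[Vm mV] mb]] := CS n.
exists (size v0 + m); last by rewrite prefix_catw -(xV n.+1).
exact: leq_trans (Vsize n) (leq_trans Vm (leq_addl _ _)).
Qed.

End Pumping.

(** * The co-Büchi condition on the original structure *)

Lemma loops_accepted w r : is_run Q0 delta w r ->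
  (forall q, inf_of r q -> accepting_loop q) -> accepts Q0 delta acc w.
Proof.
move=> [r0 wr] loops; apply: NNPP => nacc.
have [N NP] := eventually_inf r.
have sinf n : inf_of (shift N r) (shift N r n).
  by apply/inf_shift/NP/leq_addr.
have sr := steps_shift N wr.
have [n|cyc cycP] := accepting_cycle sr sinf; first by apply/loops/NP/leq_addr.
(* Pumping needs a word with exact residual at the start of the tail; the prefix of [w] is replaced
   by a word on which [g] itself reaches that state. *)
have [v [vr _]] := g_uses (sr 0).
have [? _ _ ? ?] := cycP (w 0).
apply: (@pump_contradiction v (shift N w) (shift N r) cyc) => //.
- by rewrite -vr; apply: residual_strategy.
- rewrite /shift addn0 => /(lang_splice wr) lr; apply: nacc.
  by apply/accepts_lang; exists (r 0).
- by move=> a; have [] := cycP a.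
- by move=> a; have [] := cycP a.
Qed.

Lemma cobuchi_type : exists alpha' : {set Q},
  GFG Q0 delta (cobuchi_acc alpha') /\
  forall w, accepts Q0 delta (cobuchi_acc alpha') w <-> accepts Q0 delta acc w.
Proof.
have [alpha' alphaP] := classical_set (fun q => ~ accepting_loop q).
exists alpha'.
have sound w : accepts Q0 delta (cobuchi_acc alpha') w -> accepts Q0 delta acc w.
  move=> [r [rw ar]]; apply: (loops_accepted rw) => q /ar/negP nq.
  by apply: NNPP => /alphaP.
have complete w : accepts Q0 delta acc w ->
    cobuchi_acc alpha' (inf_of (fun i => g (prefix w i))).
  have [[_ wg] gacc] := g_gfg w; move=> /gacc ga q qi.
  by apply/negP => /alphaP; apply; apply: accepting_run_loop wg ga qi.
split=> [|w].
  (* The Streett strategy also serves for the co-Büchi condition: on words of the language its run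
     ends up among states on accepting loops. *)
  exists g => w; split; first by have [] := g_gfg w.
  by move/sound; apply: complete.
split=> [/sound //|lw]; exists (fun i => g (prefix w i)).
by split; [have [] := g_gfg w | apply: complete].
Qed.

End Automata.

Theorem theorem10 (Sigma Q : finType) (Q0 : {set Q}) (delta : Q -> Sigma -> {set Q})
  (alpha : seq ({set Q} * {set Q})) :
  GFG Q0 delta (streett_acc alpha) ->
  tight Q0 delta alpha ->
  (exists (Q' : finType) (Q0' : {set Q'}) (delta' : Q' -> Sigma -> {set Q'})
          (beta : {set Q'}),
      GFG Q0' delta' (cobuchi_acc beta) /\
      forall w, accepts Q0' delta' (cobuchi_acc beta) w <->
                accepts Q0 delta (streett_acc alpha) w) ->
  exists alpha' : {set Q},
    GFG Q0 delta (cobuchi_acc alpha') /\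
    forall w, accepts Q0 delta (cobuchi_acc alpha') w <->
              accepts Q0 delta (streett_acc alpha) w.
Proof.
move=> _ [g [g_gfg [g_uses _]]] [Q' [Q0' [delta' [beta [[h h_gfg] h_lang]]]]].
exact (cobuchi_type g_gfg g_uses h_gfg h_lang).
Qed.
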